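(* Let $A$ be an associative unital $\mathbb{C}$-algebra whose Arens-Michael envelope $\widehat A$ is a Fréchet algebra, and let $\alpha \in \mathrm{Aut}(A)$ be an arbitrary algebra automorphism. Then there is an isomorphism $$\bigl(A[t,t^{-1};\alpha]\bigr)^{\widehat{\ }} = \widehat{L_A(A_\alpha)} \cong \widehat{L}_{\widehat{A}}(\widehat{A}_{\widehat{\alpha}}).$$
   Context: An Arens-Michael algebra is a complete locally convex algebra whose topology is defined by submultiplicative seminorms. The Arens-Michael envelope of an algebra $A$ is an Arens-Michael algebra $\widehat A$ with a homomorphism $i_A:A\to\widehat A$ through which every homomorphism from $A$ to an Arens-Michael algebra factors uniquely via a continuous homomorphism. $\widehat\alpha$ is the unique continuous automorphism of $\widehat A$ with $\widehat\alpha\circ i_A=i_A\circ\alpha$. For an algebra $A$ and an endomorphism $\alpha$, $A_\alpha$ is the $A$-bimodule equal to $A$ as a left module with right action $x\circ a=x\alpha(a)$. For an automorphism $\alpha$, $A[t,t^{-1};\alpha]=\{\sum_{i=-n}^n a_it^i: a_i\in A\}$ is the Laurent Ore extension, with multiplication determined by $ta=\alpha(a)t$ and by $A$ and $\mathbb C[t,t^{-1}]$ being subalgebras. $A_\alpha$ and $A_{\alpha^{-1}}$ are inverse $A$-bimodules with respect to $i_1(a\otimes b)=a\alpha(b)$, $i_2(b\otimes a)=b\alpha^{-1}(a)$. The Laurent tensor algebra of an invertible bimodule $M$ with inverse $M^{-1}$ (with respect to bimodule isomorphisms $i_1:M\otimes_AM^{-1}\to A$, $i_2:M^{-1}\otimes_AM\to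 A$) is $L_A(M)=\bigoplus_{n\in\mathbb Z}M^{\otimes n}$ ($M^{\otimes0}=A$, $M^{\otimes-n}=(M^{-1})^{\otimes n}$) with the multiplication extending those of the tensor algebras $T_A(M)$, $T_A(M^{-1})$ and satisfying $x\cdot y=i_1(x\otimes y)$, $y\cdot x=i_2(y\otimes x)$ for $x\in M$, $y\in M^{-1}$; one has $L_A(A_\alpha)\simeq A[t,t^{-1};\alpha]$. Let $A$ be an Arens-Michael algebra and $M,M^{-1}$ topologically inverse $A$-$\hat\otimes$-bimodules (complete locally convex spaces with jointly continuous actions) with respect to topological bimodule isomorphisms $i_1:M\hat\otimes_AM^{-1}\to A$, $i_2:M^{-1}\hat\otimes_AM\to A$ satisfying $i_1(x\otimes y)x'=x\,i_2(y\otimes x')$, $i_2(y\otimes x)y'=y\,i_1(x\otimes y')$. A triple $(\theta,\alpha,\beta,B)$, with $B$ an Arens-Michael algebra, $\theta:A\to B$ a continuous homomorphism, $\alpha:M\to B$ and $\beta:M^{-1}\to B$ continuous $A$-bimodule homomorphisms, is topologically compatible if $\alpha(x)\beta(y)=\theta(i_1(x\otimes y))$ and $\beta(y)\alpha(x)=\theta(i_2(y\otimes x))$ for all $x\in M,y\in M^{-1}$. The topological Laurent tensor algebra $\widehat L_A(M)$ is the Arens-Michael algebra carrying a universal topologically compatible triple (every topologically compatible triple arises from it by composition with a unique continuous $A$-algebra homomorphism). In the claim it is formed for the Arens-Michael algebra $\widehat A$ and the topologically inverse bimodules $\widehat A_{\widehat\alpha}$, $\widehat A_{\widehat\alpha^{-1}}$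 with $i_1(a\otimes b)=a\widehat\alpha(b)$, $i_2(b\otimes a)=b\widehat\alpha^{-1}(a)$. *)

(* Defs.v *)
From HB Require Import structures.
From mathcomp Require Import all_boot all_order all_algebra.
From mathcomp Require Import finmap.
From mathcomp Require Import boolp classical_sets functions topology.
From mathcomp Require Import normedtype.

Set Implicit Arguments.
Unset Strict Implicit.
Unset Printing Implicit Defensive.

Import Order.TTheory GRing.Theory Num.Theory.
Import numFieldNormedType.Exports.

Local Open Scope classical_set_scope.
Local Open Scope ring_scope.

Reserved Notation "x ** y" (at level 40, left associativity).

(* MathComp's [algType] requires 1 != 0, but the Arens-Michael envelope of a
   nonzero algebra may be zero (the Weyl algebra), so the zero algebra has to be
   allowed. HB refuses a structure joining [lmodType] and [pzRingType] on top of
   the existing hierarchy, whence the separate product below. *)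
HB.mixin Record hasAlgebraMul (K : fieldType) A & GRing.Lmodule K A := {
  aone : A;
  amul : A -> A -> A;
  amulA : associative amul;
  amul1x : left_id aone amul;
  amulx1 : right_id aone amul;
  amulDl : left_distributive amul +%R;
  amulDr : right_distributive amul +%R;
  amulZl : forall (k : K) x y, amul (k *: x) y = k *: amul x y;
  amulZr : forall (k : K) x y, amul x (k *: y) = k *: amul x y
}.

#[short(type="algebraType")]
HB.structure Definition UnitalAlgebra (K : fieldType) :=
  {A of GRing.Lmodule K A & hasAlgebraMul K A}.

Notation "x ** y" := (amul x y) : ring_scope.
Arguments aone {K s}.

Definition alg_hom (K : fieldType) (A B : algebraType K) (f : A -> B) : Prop :=
  [/\ linear f, f aone = aone & forall x y, f (x ** y) = f x ** f y].

Record alg_aut (K : fieldType) (A : algebraType K) := AlgAut {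
  aut :> A -> A;
  aut_inv : A -> A;
  aut_hom : alg_hom aut;
  autK : cancel aut aut_inv;
  aut_invK : cancel aut_inv aut
}.

Definition seminorm (K : numFieldType) (V : lmodType K) (p : V -> K) : Prop :=
  [/\ forall x, 0 <= p x,
      forall k x, p (k *: x) = `|k| * p x &
      forall x y, p (x + y) <= p x + p y].

Definition topology_defined_by (K : numFieldType) (V : topologicalLmodType K)
    (P : set (V -> K)) : Prop :=
  forall (x : V) (U : set V),
    nbhs x U <-> exists n (p : 'I_n -> V -> K) (e : K),
      [/\ forall i, P (p i), 0 < e &
          [set y | forall i, p i (y - x) < e] `<=` U].

(* The library's [tvsType] comes with an arbitrary uniformity inducing the
   topology; completeness must refer to the uniformity given by the addition. *)
HB.mixin Record isCompleteLcs (K : numFieldType) V & TopologicalLmodule K V := {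
  lcs_hausdorff : hausdorff_space V;
  lcs_seminorms : exists2 P : set (V -> K),
    forall p, P p -> seminorm p & topology_defined_by P;
  lcs_complete : forall F : set_system V, ProperFilter F ->
    (forall U, nbhs (0 : V) U ->
      exists2 B, F B & forall x y, B x -> B y -> U (x - y)) ->
    exists l : V, F --> l
}.

#[short(type="completeLcsType")]
HB.structure Definition CompleteLcs (K : numFieldType) :=
  {V of TopologicalLmodule K V & isCompleteLcs K V}.

HB.mixin Record isArensMichael (K : numFieldType) A
    & CompleteLcs K A & UnitalAlgebra K A := {
  am_seminorms : exists2 P : set (A -> K),
    forall p, P p -> seminorm p /\ forall x y, p (x ** y) <= p x * p y &
    topology_defined_by P
}.

#[short(type="arensMichaelType")]
HB.structure Definition ArensMichael (K : numFieldType) :=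
  {A of CompleteLcs K A & UnitalAlgebra K A & isArensMichael K A}.

Definition frechet (K : numFieldType) (V : completeLcsType K) : Prop :=
  exists p : nat -> V -> K,
    (forall n, seminorm (p n)) /\ topology_defined_by (range p).

Definition top_alg_iso (K : numFieldType) (A B : arensMichaelType K)
    (f : A -> B) : Prop :=
  [/\ alg_hom f, continuous f &
      exists g : B -> A, [/\ cancel f g, cancel g f & continuous g]].

Record top_alg_aut (K : numFieldType) (A : arensMichaelType K) := TopAlgAut {
  top_aut :> alg_aut A;
  top_aut_cont : continuous (top_aut : A -> A);
  top_aut_inv_cont : continuous (aut_inv top_aut)
}.

Definition is_am_envelope (K : numFieldType) (A : algebraType K)
    (Ah : arensMichaelType K) (i : A -> Ah) : Prop :=
  alg_hom i /\
  forall (B : arensMichaelType K) (f : A -> B), alg_hom f ->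
    exists! g : Ah -> B, [/\ alg_hom g, continuous g & g \o i = f].

Definition bimodule_laws (K : fieldType) (A : algebraType K) (M : lmodType K)
    (l : A -> M -> M) (r : M -> A -> M) : Prop :=
  [/\ [/\ forall a, linear (l a), forall x, linear (l^~ x),
          forall x, l aone x = x & forall a b x, l (a ** b) x = l a (l b x)],
      [/\ forall a, linear (r^~ a), forall x, linear (r x),
          forall x, r x aone = x & forall a b x, r x (a ** b) = r (r x a) b] &
      forall a x b, l a (r x b) = r (l a x) b].

Record bimodule (K : fieldType) (A : algebraType K) := Bimodule {
  bm_sort :> lmodType K;
  lact : A -> bm_sort -> bm_sort;
  ract : bm_sort -> A -> bm_sort;
  bm_laws : bimodule_laws lact ract
}.

Definition bimodule_hom (K : fieldType) (A : algebraType K)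
    (M N : bimodule A) (f : M -> N) : Prop :=
  [/\ linear f, forall a x, f (lact a x) = lact a (f x) &
      forall x a, f (ract x a) = ract (f x) a].

Definition bilinear_map (K : fieldType) (U V W : lmodType K)
    (f : U -> V -> W) : Prop :=
  (forall x, linear (f x)) /\ (forall y, linear (f^~ y)).

Definition balanced (K : fieldType) (A : algebraType K) (M N : bimodule A)
    (E : lmodType K) (f : M -> N -> E) : Prop :=
  bilinear_map f /\ forall x a y, f (ract x a) y = f x (lact a y).

(* [T], with [tau x y] in the role of x (x) y, is the A-bimodule M (x)_A N. *)
Definition is_tensor (K : fieldType) (A : algebraType K) (M N T : bimodule A)
    (tau : M -> N -> T) : Prop :=
  [/\ balanced tau,
      forall a x y, tau (lact a x) y = lact a (tau x y),
      forall x y a, tau x (ract y a) = ract (tau x y) a &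
      forall (E : lmodType K) (f : M -> N -> E), balanced f ->
        exists! g : T -> E, linear g /\ forall x y, g (tau x y) = f x y].

Section AlgebraTheory.
Context (K : fieldType) (A : algebraType K).

Lemma linear_amull (a : A) : linear (amul a).
Proof. by move=> k x y; rewrite amulDr amulZr. Qed.

Lemma linear_amulr (a : A) : linear (amul^~ a).
Proof. by move=> k x y; rewrite amulDl amulZl. Qed.

Lemma amul0 (a : A) : a ** 0 = 0.
Proof. by apply: (addIr (a ** 0)); rewrite -amulDr !add0r. Qed.

Lemma amul0l (a : A) : 0 ** a = 0.
Proof. by apply: (addIr (0 ** a)); rewrite -amulDl !add0r. Qed.

Lemma amulBl (a b c : A) : (a - b) ** c = a ** c - b ** c.
Proof. by rewrite -scaleN1r amulDl amulZl scaleN1r. Qed.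

Lemma amulBr (a b c : A) : c ** (a - b) = c ** a - c ** b.
Proof. by rewrite -scaleN1r amulDr amulZr scaleN1r. Qed.

Lemma alg_homD (B : algebraType K) (f : A -> B) : alg_hom f ->
  {morph f : x y / x + y}.
Proof. by case=> fl _ _ x y; have := fl 1 x y; rewrite !scale1r. Qed.

Lemma alg_hom0 (B : algebraType K) (f : A -> B) : alg_hom f -> f 0 = 0.
Proof. by move=> /alg_homD fD; apply: (addIr (f 0)); rewrite -fD !add0r. Qed.

Lemma alg_homZ (B : algebraType K) (f : A -> B) k : alg_hom f ->
  {morph f : x / k *: x}.
Proof.
move=> hf x; have [fl _ _] := hf.
by have := fl k x 0; rewrite !addr0 (alg_hom0 hf) addr0.
Qed.

Lemma alg_hom_id : alg_hom (@id A).
Proof. by []. Qed.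

Lemma alg_hom_comp (f g : A -> A) : alg_hom f -> alg_hom g -> alg_hom (f \o g).
Proof.
move=> [fl f1 fM] [gl g1 gM]; split; rewrite /= ?g1 ?f1//.
  by move=> k x y /=; rewrite gl fl.
by move=> x y /=; rewrite gM fM.
Qed.

Lemma aut_inv_hom (s : alg_aut A) : alg_hom (aut_inv s).
Proof.
have [sl s1 sM] := aut_hom s; have sI := can_inj (autK s).
split=> [k x y||x y].
- by apply: sI; rewrite sl !aut_invK.
- by apply: sI; rewrite aut_invK s1.
- by apply: sI; rewrite sM !aut_invK.
Qed.

Definition aut_sym (s : alg_aut A) : alg_aut A :=
  AlgAut (aut_inv_hom s) (aut_invK s) (autK s).

Lemma twist_laws (s : A -> A) : alg_hom s ->
  bimodule_laws (M := A) amul (fun x a => x ** s a).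
Proof.
move=> [sl s1 sM]; split; first split.
- exact: linear_amull.
- exact: linear_amulr.
- exact: amul1x.
- by move=> a b x; rewrite amulA.
- split.
  + by move=> a; apply: linear_amulr.
  + by move=> x k a b; rewrite sl linear_amull.
  + by move=> x; rewrite s1 amulx1.
  + by move=> a b x; rewrite sM amulA.
- by move=> a x b; rewrite amulA.
Qed.

(* A_s *)
Definition twist (s : alg_aut A) : bimodule A := Bimodule (twist_laws (aut_hom s)).

Definition regular : bimodule A := Bimodule (twist_laws alg_hom_id).

End AlgebraTheory.

(* [inv_i1] stands for (x, y) |-> i_1(x (x) y): since tensor products are given
   by their universal property, i_1 : M (x)_A M^-1 -> A is an isomorphism of
   bimodules exactly when A together with this map is a model of M (x)_A M^-1. *)
Record inverse_bimodules (K : fieldType) (A : algebraType K) :=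
    InverseBimodules {
  inv_fwd : bimodule A;
  inv_bwd : bimodule A;
  inv_i1 : inv_fwd -> inv_bwd -> regular A;
  inv_i2 : inv_bwd -> inv_fwd -> regular A;
  inv_i1_iso : is_tensor inv_i1;
  inv_i2_iso : is_tensor inv_i2
}.

(* [lta_pow n] is the n-th tensor power of M for n >= 0, and the (-n)-th tensor
   power of M^-1 for n <= 0, built from the regular bimodule by tensoring on the
   right; [lta_emb n] is its embedding in the direct sum. *)
Record laurent_tensor_algebra (K : fieldType) (A : algebraType K)
    (I : inverse_bimodules A) := LaurentTensorAlgebra {
  lta_alg :> algebraType K;
  lta_pow : int -> bimodule A;
  lta_unit : regular A -> lta_pow 0;
  lta_tensP : forall n : nat, lta_pow n%:Z -> inv_fwd I -> lta_pow n.+1%:Z;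
  lta_tensN : forall n : nat,
    lta_pow (- n%:Z) -> inv_bwd I -> lta_pow (- n.+1%:Z);
  lta_unit_iso : bimodule_hom lta_unit /\ bijective lta_unit;
  lta_tensP_tensor : forall n, is_tensor (@lta_tensP n);
  lta_tensN_tensor : forall n, is_tensor (@lta_tensN n);
  lta_emb : forall n, lta_pow n -> lta_alg;
  lta_emb_linear : forall n, linear (@lta_emb n);
  lta_direct_sum : forall (E : lmodType K) (f : forall n, lta_pow n -> E),
    (forall n, linear (f n)) ->
    exists! g : lta_alg -> E,
      linear g /\ forall n w, g (lta_emb w) = f n w;
  lta_of_alg : A -> lta_alg := fun a => lta_emb (lta_unit a);
  lta_fwd : inv_fwd I -> lta_alg :=
    fun x => lta_emb (lta_tensP (lta_unit aone : lta_pow 0%:Z) x);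
  lta_bwd : inv_bwd I -> lta_alg :=
    fun y => lta_emb (lta_tensN (lta_unit aone : lta_pow (- 0%:Z)) y);
  lta_of_alg_hom : alg_hom lta_of_alg;
  lta_emb_lact : forall n a (w : lta_pow n),
    lta_emb (lact a w) = lta_of_alg a ** lta_emb w;
  lta_emb_ract : forall n (w : lta_pow n) a,
    lta_emb (ract w a) = lta_emb w ** lta_of_alg a;
  lta_mulP : forall n (w : lta_pow n%:Z) x,
    lta_emb w ** lta_fwd x = lta_emb (lta_tensP w x);
  lta_mulN : forall n (w : lta_pow (- n%:Z)) y,
    lta_emb w ** lta_bwd y = lta_emb (lta_tensN w y);
  lta_fwd_bwd : forall x y, lta_fwd x ** lta_bwd y = lta_of_alg (inv_i1 x y);
  lta_bwd_fwd : forall y x, lta_bwd y ** lta_fwd x = lta_of_alg (inv_i2 y x)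
}.

Section TwistTensor.
Context (K : fieldType) (A : algebraType K) (s s' : alg_aut A).
Hypotheses (sK : cancel s s') (s'K : cancel s' s).

Definition twist_mul : twist s -> twist s' -> regular A := fun a b => a ** s b.

Lemma twist_mul_balanced : balanced twist_mul.
Proof.
have [sl s1 sM] := aut_hom s.
split=> [|x a y]; last by rewrite /twist_mul /= sM amulA.
split=> [x k a b|y k a b]; rewrite /twist_mul ?sl.
  exact: linear_amull.
exact: linear_amulr.
Qed.

Lemma balanced_twist (E : lmodType K) (f : twist s -> twist s' -> E) :
  balanced f -> forall x y, f (twist_mul x y) aone = f x y.
Proof.
move=> [_ fb] x y; rewrite /twist_mul -[in RHS](amulx1 (y : A)).
by rewrite -(fb x y aone).
Qed.

Lemma twist_tensor : is_tensor twist_mul.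
Proof.
have [sl s1 sM] := aut_hom s.
split; first exact: twist_mul_balanced.
- by move=> a x y; rewrite /twist_mul /= amulA.
- by move=> x y a; rewrite /twist_mul /= sM s'K amulA.
move=> E f fb; exists (f^~ aone); split.
  split; last exact: balanced_twist.
  by case: fb => -[_ fl] _; apply: fl.
move=> g [_ gf]; apply: funext => x; rewrite -gf /twist_mul s1.
exact: (congr1 g (amulx1 (x : A))).
Qed.

End TwistTensor.

Definition twist_inverse (K : fieldType) (A : algebraType K) (s : alg_aut A) :
    inverse_bimodules A :=
  InverseBimodules (twist_tensor (s := s) (s' := aut_sym s) (aut_invK s))
                   (twist_tensor (s := aut_sym s) (s' := s) (autK s)).

Section LaurentOre.
Context (K : fieldType) (A : algebraType K) (s : alg_aut A).

Definition autz (n : int) : A -> A :=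
  match n with
  | Posz n => iter n s
  | Negz n => iter n.+1 (aut_inv s)
  end.

Lemma autz_hom n : alg_hom (autz n).
Proof.
have H (f : A -> A) m : alg_hom f -> alg_hom (iter m f).
  by move=> hf; elim: m => [|m IH]; [exact: alg_hom_id|exact: (alg_hom_comp hf)].
by case: n => m; apply: H; [exact: aut_hom|exact: aut_inv_hom].
Qed.

Lemma autzS n x : autz (n + 1) x = s (autz n x).
Proof.
case: n => [n|[|n]]; first by rewrite -PoszD addn1.
  by rewrite /= aut_invK.
have -> : Negz n.+1 + 1 = Negz n.
  by rewrite !NegzE -[n.+2]addn1 PoszD opprD subrK.
by rewrite /= aut_invK.
Qed.

Lemma autzB n x : autz (n - 1) x = aut_inv s (autz n x).
Proof. by rewrite -{2}(subrK 1 n) autzS autK. Qed.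

Lemma autzD m n x : autz (m + n) x = autz m (autz n x).
Proof.
elim/int_ind: m => [|m IH|m IH]; first by rewrite add0r.
- by rewrite -addn1 PoszD addrAC !autzS IH.
- by rewrite -addn1 PoszD opprD addrAC !autzB IH.
Qed.

(* The coefficient of t^n in f is [f n]. The automorphism is a phantom argument:
   the product below depends on it. *)
Definition laurent_ore of alg_aut A := {fsfun int -> A with 0}.

Local Notation ore := (laurent_ore s).

HB.instance Definition _ := Choice.on ore.

Implicit Types f g h : ore.

Lemma finsupp0 f n : n \notin finsupp f -> f n = 0.
Proof. exact: fsfun_dflt. Qed.

Definition ore0 : ore := [fsfun].

Definition ore_add f g : ore :=
  [fsfun n in (finsupp f `|` finsupp g)%fset => f n + g n].

Definition ore_scale (k : K) f : ore :=
  [fsfun n in finsupp f => k *: f n].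

Definition ore_opp f : ore := ore_scale (-1) f.

Lemma ore0E n : ore0 n = 0.
Proof. by rewrite fsfun0E. Qed.

Lemma ore_addE f g n : ore_add f g n = f n + g n.
Proof.
rewrite fsfunE in_fsetU; case: ifPn => // /norP[nf ng].
by rewrite !finsupp0// addr0.
Qed.

Lemma ore_scaleE k f n : ore_scale k f n = k *: f n.
Proof. by rewrite fsfunE; case: ifPn => // nf; rewrite finsupp0// scaler0. Qed.

Lemma ore_addA : associative ore_add.
Proof. by move=> f g h; apply/fsfunP => n; rewrite !ore_addE addrA. Qed.

Lemma ore_addC : commutative ore_add.
Proof. by move=> f g; apply/fsfunP => n; rewrite !ore_addE addrC. Qed.

Lemma ore_add0 : left_id ore0 ore_add.
Proof. by move=> f; apply/fsfunP => n; rewrite ore_addE ore0E add0r. Qed.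

Lemma ore_addN : left_inverse ore0 ore_opp ore_add.
Proof.
move=> f; apply/fsfunP => n.
by rewrite ore_addE ore0E ore_scaleE scaleN1r addNr.
Qed.

HB.instance Definition _ :=
  GRing.isZmodule.Build ore ore_addA ore_addC ore_add0 ore_addN.

Lemma oreD f g n : (f + g) n = f n + g n.
Proof. exact: ore_addE. Qed.

Lemma ore_zeroE n : (0 : ore) n = 0.
Proof. exact: ore0E. Qed.

Lemma ore_scaleA a b f : ore_scale a (ore_scale b f) = ore_scale (a * b) f.
Proof. by apply/fsfunP => n; rewrite !ore_scaleE scalerA. Qed.

Lemma ore_scale1 : left_id 1 ore_scale.
Proof. by move=> f; apply/fsfunP => n; rewrite ore_scaleE scale1r. Qed.

Lemma ore_scaleDr : right_distributive ore_scale +%R.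
Proof.
by move=> k f g; apply/fsfunP => n; rewrite !(oreD, ore_scaleE) scalerDr.
Qed.

Lemma ore_scaleDl f : {morph ore_scale^~ f : a b / a + b}.
Proof.
by move=> a b; apply/fsfunP => n; rewrite !(oreD, ore_scaleE) scalerDl.
Qed.

HB.instance Definition _ := GRing.Zmodule_isLmodule.Build K ore
  ore_scaleA ore_scale1 ore_scaleDr ore_scaleDl.

Lemma oreZ k f n : (k *: f) n = k *: f n.
Proof. exact: ore_scaleE. Qed.

(* The element a t^n. *)
Definition ore_mono (a : A) (n : int) : ore :=
  [fsfun m in [fset n]%fset => a].

(* (sum_i a_i t^i) (sum_j b_j t^j) = sum_i sum_j a_i s^i(b_j) t^(i + j) *)
Definition ore_mul f g : ore :=
  \sum_(i <- finsupp f) \sum_(j <- finsupp g)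
     ore_mono (f i ** autz i (g j)) (i + j).

Lemma ore_monoE a n m : ore_mono a n m = if m == n then a else 0.
Proof. by rewrite fsfunE inE. Qed.

Lemma ore_sumE (I : Type) (r : seq I) (F : I -> ore) n :
  (\sum_(i <- r) F i) n = \sum_(i <- r) F i n.
Proof.
elim: r => [|i r IH]; first by rewrite !big_nil ore_zeroE.
by rewrite !big_cons oreD IH.
Qed.

Lemma ore_monoD n : {morph ore_mono^~ n : a b / a + b}.
Proof.
move=> a b; apply/fsfunP => m; rewrite oreD !ore_monoE.
by case: ifP; rewrite ?addr0.
Qed.

Lemma ore_monoZ n k a : ore_mono (k *: a) n = k *: ore_mono a n.
Proof.
by apply/fsfunP => m; rewrite oreZ !ore_monoE; case: ifP; rewrite ?scaler0.
Qed.

Lemma ore_mono0 n : ore_mono 0 n = 0.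
Proof. by apply/fsfunP => m; rewrite ore_zeroE ore_monoE if_same. Qed.

Lemma big_finsupp_widen (G : zmodType) f (S : {fset int}) (F : int -> A -> G) :
  (finsupp f `<=` S)%fset -> (forall i, F i 0 = 0) ->
  \sum_(i <- finsupp f) F i (f i) = \sum_(i <- S) F i (f i).
Proof.
move=> fS F0; apply: big_fset_incl => // i _ /finsupp0 ->; exact: F0.
Qed.

Lemma big_finsuppD (G : zmodType) f g (F : int -> A -> G) :
  (forall i, {morph F i : a b / a + b}) ->
  \sum_(i <- finsupp (f + g)) F i ((f + g) i) =
  \sum_(i <- finsupp f) F i (f i) + \sum_(i <- finsupp g) F i (g i).
Proof.
move=> FD; have F0 i : F i 0 = 0.
  by apply: (addIr (F i 0)); rewrite -FD !add0r.
pose S := (finsupp f `|` finsupp g `|` finsupp (f + g)%R)%fset.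
rewrite !(@big_finsupp_widen _ _ S F)//.
- by rewrite -big_split; apply: eq_bigr => i _; rewrite oreD FD.
- by apply/fsubsetP => i; rewrite !inE => ->; rewrite orbT.
- by apply/fsubsetP => i; rewrite !inE => ->.
- by apply/fsubsetP => i; rewrite !inE => ->; rewrite orbT.
Qed.

Lemma big_finsuppZ (G : lmodType K) k f (F : int -> A -> G) :
  (forall i a, F i (k *: a) = k *: F i a) -> (forall i, F i 0 = 0) ->
  \sum_(i <- finsupp (k *: f)) F i ((k *: f) i) =
  k *: \sum_(i <- finsupp f) F i (f i).
Proof.
move=> FZ F0; rewrite (@big_finsupp_widen _ _ (finsupp f) F)//.
  by rewrite scaler_sumr; apply: eq_bigr => i _; rewrite oreZ FZ.
apply/fsubsetP => i; apply: contraLR => /finsupp0 fi.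
by rewrite mem_finsupp negbK oreZ fi scaler0.
Qed.

Lemma big_finsupp_mono (G : zmodType) a n (F : int -> A -> G) :
  (forall i, F i 0 = 0) ->
  \sum_(i <- finsupp (ore_mono a n)) F i (ore_mono a n i) = F n a.
Proof.
move=> F0; rewrite (@big_finsupp_widen _ _ [fset n]%fset F)//.
  by rewrite big_seq_fset1 ore_monoE eqxx.
apply/fsubsetP => i; rewrite inE; apply: contraLR => ni.
by rewrite mem_finsupp negbK ore_monoE (negbTE ni).
Qed.

Lemma ore_expand f : f = \sum_(i <- finsupp f) ore_mono (f i) i.
Proof.
apply/fsfunP => n; rewrite ore_sumE.
have [nf|nf] := boolP (n \in finsupp f).
  rewrite (big_fsetD1 n)//= ore_monoE eqxx big1_fset ?addr0// => i.
  by rewrite !inE ore_monoE => /andP[/negbTE + _ _]; rewrite eq_sym => ->.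
rewrite finsupp0// big1_fset// => i if_ _; rewrite ore_monoE; case: eqP => // ni.
by rewrite -ni finsupp0.
Qed.

Lemma autz_add n : {morph autz n : a b / a + b}.
Proof. exact: alg_homD (autz_hom n). Qed.

Lemma ore_mulDl : left_distributive ore_mul +%R.
Proof.
move=> f g h; rewrite /ore_mul.
rewrite (@big_finsuppD _ f g (fun i a =>
  \sum_(j <- finsupp h) ore_mono (a ** autz i (h j)) (i + j)))// => i a b.
by rewrite -big_split; apply: eq_bigr => j _; rewrite amulDl ore_monoD.
Qed.

Lemma ore_mulDr : right_distributive ore_mul +%R.
Proof.
move=> f g h; rewrite /ore_mul -big_split; apply: eq_bigr => i _.
rewrite (@big_finsuppD _ g h (fun j b => ore_mono (f i ** autz i b) (i + j)))//.
by move=> j a b; rewrite autz_add amulDr ore_monoD.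
Qed.

Lemma ore_mulZl k f g : ore_mul (k *: f) g = k *: ore_mul f g.
Proof.
rewrite /ore_mul (@big_finsuppZ _ k f (fun i a =>
  \sum_(j <- finsupp g) ore_mono (a ** autz i (g j)) (i + j)))// => [i a|i].
  by rewrite scaler_sumr; apply: eq_bigr => j _; rewrite amulZl ore_monoZ.
by rewrite big1// => j _; rewrite amul0l ore_mono0.
Qed.

Lemma ore_mulZr k f g : ore_mul f (k *: g) = k *: ore_mul f g.
Proof.
rewrite /ore_mul scaler_sumr; apply: eq_bigr => i _.
rewrite (@big_finsuppZ _ k g (fun j b => ore_mono (f i ** autz i b) (i + j)))//.
  by move=> j a; rewrite (alg_homZ _ (autz_hom i)) amulZr ore_monoZ.
by move=> j; rewrite (alg_hom0 (autz_hom i)) amul0 ore_mono0.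
Qed.

Lemma ore_mul_mono a m b n :
  ore_mul (ore_mono a m) (ore_mono b n) = ore_mono (a ** autz m b) (m + n).
Proof.
rewrite /ore_mul (@big_finsupp_mono _ a m (fun i a =>
    \sum_(j <- finsupp (ore_mono b n))
       ore_mono (a ** autz i (ore_mono b n j)) (i + j))).
  rewrite (@big_finsupp_mono _ b n
    (fun j b => ore_mono (a ** autz m b) (m + j)))// => i.
  by rewrite (alg_hom0 (autz_hom m)) amul0 ore_mono0.
by move=> i; rewrite big1// => j _; rewrite amul0l ore_mono0.
Qed.

Lemma ore_mul0l f : ore_mul 0 f = 0.
Proof. by apply: (addIr (ore_mul 0 f)); rewrite -ore_mulDl !add0r. Qed.

Lemma ore_mul0r f : ore_mul f 0 = 0.
Proof. by apply: (addIr (ore_mul f 0)); rewrite -ore_mulDr !add0r. Qed.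

Lemma ore_mul_suml (I : Type) (r : seq I) (F : I -> ore) g :
  ore_mul (\sum_(i <- r) F i) g = \sum_(i <- r) ore_mul (F i) g.
Proof.
elim: r => [|i r IH]; first by rewrite !big_nil ore_mul0l.
by rewrite !big_cons ore_mulDl IH.
Qed.

Lemma ore_mul_sumr (I : Type) (r : seq I) (F : I -> ore) f :
  ore_mul f (\sum_(i <- r) F i) = \sum_(i <- r) ore_mul f (F i).
Proof.
elim: r => [|i r IH]; first by rewrite !big_nil ore_mul0r.
by rewrite !big_cons ore_mulDr IH.
Qed.

Lemma ore_mulA : associative ore_mul.
Proof.
move=> f g h; rewrite (ore_expand f) (ore_expand g) (ore_expand h).
rewrite !ore_mul_suml; apply: eq_bigr => i _.
rewrite [LHS]ore_mul_sumr.
rewrite [ore_mul _ (\sum_(_ <- finsupp g) _)]ore_mul_sumr [RHS]ore_mul_suml.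
apply: eq_bigr => j _.
rewrite !ore_mul_sumr; apply: eq_bigr => k _.
rewrite !ore_mul_mono addrA autzD; congr ore_mono.
by have [_ _ ->] := autz_hom i; rewrite amulA.
Qed.

Definition ore1 : ore := ore_mono aone 0.

Lemma ore_mul1 : left_id ore1 ore_mul.
Proof.
move=> f; rewrite {1}(ore_expand f) ore_mul_sumr [RHS]ore_expand.
by apply: eq_bigr => i _; rewrite ore_mul_mono amul1x add0r.
Qed.

Lemma ore_mulr1 : right_id ore1 ore_mul.
Proof.
move=> f; rewrite {1}(ore_expand f) ore_mul_suml [RHS]ore_expand.
apply: eq_bigr => i _; rewrite ore_mul_mono addr0.
by have [_ -> _] := autz_hom i; rewrite amulx1.
Qed.

HB.instance Definition _ := hasAlgebraMul.Build K ore
  ore_mulA ore_mul1 ore_mulr1 ore_mulDl ore_mulDr ore_mulZl ore_mulZr.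

End LaurentOre.

Record top_bimodule (K : numFieldType) (A : arensMichaelType K) := TopBimodule {
  tbm_sort :> completeLcsType K;
  tlact : A -> tbm_sort -> tbm_sort;
  tract : tbm_sort -> A -> tbm_sort;
  tbm_laws : bimodule_laws tlact tract;
  tlact_cont : continuous (fun z : A * tbm_sort => tlact z.1 z.2);
  tract_cont : continuous (fun z : tbm_sort * A => tract z.1 z.2)
}.

Definition tbm_bimodule (K : numFieldType) (A : arensMichaelType K)
    (M : top_bimodule A) : bimodule A := Bimodule (tbm_laws M).

(* [T], with [tau x y] in the role of x (x) y, is the completed projective tensor
   product of M and N over A. *)
Definition is_top_tensor (K : numFieldType) (A : arensMichaelType K)
    (M N T : top_bimodule A) (tau : M -> N -> T) : Prop :=
  [/\ @balanced _ _ (tbm_bimodule M) (tbm_bimodule N) T tau,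
      continuous (fun z : M * N => tau z.1 z.2),
      forall a x y, tau (tlact a x) y = tlact a (tau x y),
      forall x y a, tau x (tract y a) = tract (tau x y) a &
      forall (E : completeLcsType K) (f : M -> N -> E),
        @balanced _ _ (tbm_bimodule M) (tbm_bimodule N) E f ->
        continuous (fun z : M * N => f z.1 z.2) ->
        exists! g : T -> E,
          [/\ linear g, continuous g & forall x y, g (tau x y) = f x y]].

Lemma amul_continuous (K : numFieldType) (A : arensMichaelType K) :
  continuous (fun z : A * A => z.1 ** z.2).
Proof.
move=> [x y] U /=; have [P Psub PE] := @am_seminorms K A.
move=> /(PE (x ** y)) [n [p [e [Pp e0 pU]]]].
have p0 i a : 0 <= p i a by have [[]] := Psub _ (Pp i).
have pD i a b : p i (a + b) <= p i a + p i b by have [[]] := Psub _ (Pp i).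
have pM i a b : p i (a ** b) <= p i a * p i b by have [] := Psub _ (Pp i).
pose M := \sum_(i < n) (p i x + p i y).
have M0 : 0 <= M by apply: sumr_ge0 => i _; rewrite addr_ge0.
have pM_le i : p i x + p i y <= M.
  rewrite /M (bigD1 i)//= lerDl; apply: sumr_ge0 => j _; exact: addr_ge0.
have d0 : 0 < 1 + M + e by rewrite addr_gt0// ltr_wpDr.
pose d := e / (1 + M + e).
have dp : 0 < d by rewrite divr_gt0.
have d1 : d <= 1 by rewrite ler_pdivrMr// mul1r lerDr addr_ge0.
have dM : d * (1 + M) < e.
  rewrite -[ltRHS](divfK (lt0r_neq0 d0)) -/d [ltRHS]mulrDr ltrDl.
  exact: mulr_gt0.
have nb z : nbhs z [set z' | forall i, p i (z' - z) < d].
  by apply/PE; exists n, p, d; split.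
exists ([set z | forall i, p i (z - x) < d],
        [set z | forall i, p i (z - y) < d]) => [|[x' y'] [/= x'x y'y]].
  by split; apply: nb.
apply: pU => i /=; apply: le_lt_trans dM.
have -> : x' ** y' - x ** y = (x' - x) ** y' + x ** (y' - y).
  by rewrite amulBl amulBr addrA subrK.
apply: le_trans (pD _ _ _) _.
apply: (@le_trans _ _ (d * (1 + p i y) + p i x * d)); last first.
  rewrite [_ * d]mulrC -mulrDr ler_pM2l// -addrA lerD2l addrC.
  exact: pM_le.
apply: lerD; apply: le_trans (pM _ _ _) _; last first.
  by rewrite ler_wpM2l// ltW.
apply: ler_pM => //; first exact: ltW.
rewrite -{1}(subrK y y'); apply: le_trans (pD _ _ _) _.
by rewrite lerD2r (le_trans (ltW (y'y i))).
Qed.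

Lemma amul_comp_continuous (K : numFieldType) (A : arensMichaelType K)
    (s : A -> A) : continuous s -> continuous (fun z : A * A => z.1 ** s z.2).
Proof.
move=> sc z.
apply: (@continuous_comp _ _ _ (fun z : A * A => (z.1, s z.2))
                               (fun z : A * A => z.1 ** z.2)).
  apply: cvg_pair; first exact: cvg_fst.
  by apply: continuous_comp; [exact: cvg_snd|exact: sc].
exact: amul_continuous.
Qed.

Section TopTwist.
Context (K : numFieldType) (A : arensMichaelType K).

Definition top_aut_sym (s : top_alg_aut A) : top_alg_aut A :=
  @TopAlgAut K A (aut_sym s) (top_aut_inv_cont (t := s)) (top_aut_cont (t := s)).

Definition top_twist (s : top_alg_aut A) : top_bimodule A :=
  TopBimodule (twist_laws (aut_hom s)) (@amul_continuous K A)
    (amul_comp_continuous (top_aut_cont (t := s))).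

Definition top_regular : top_bimodule A :=
  TopBimodule (twist_laws (alg_hom_id A)) (@amul_continuous K A)
    (@amul_continuous K A).

Definition top_twist_mul (s s' : top_alg_aut A) :
  top_twist s -> top_twist s' -> top_regular := fun a b => a ** s b.

Lemma top_twist_tensor (s s' : top_alg_aut A) :
  cancel s s' -> cancel s' s -> is_top_tensor (top_twist_mul (s := s) (s' := s')).
Proof.
move=> sK s'K; have [tb tl tr _] := twist_tensor s'K.
split=> //.
  exact: (amul_comp_continuous (top_aut_cont (t := s))).
move=> E f fb fc; have fE := @balanced_twist _ _ s s' E f fb.
have [_ s1 _] := aut_hom s.
exists (f^~ aone); split.
  split; last exact: fE.
    by case: fb => -[_ fl] _; apply: fl.
  move=> x; apply: (@continuous_comp _ _ _ (fun x : A => (x, aone : A))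
                                     (fun z : A * A => f z.1 z.2)).
    by apply: cvg_pair; [exact: cvg_id|exact: cvg_cst].
  exact: fc.
move=> g [_ _ gf]; apply: funext => x; rewrite -gf /top_twist_mul s1.
exact: (congr1 g (amulx1 (x : A))).
Qed.

End TopTwist.

(* As for [inverse_bimodules], that i_1 is a topological isomorphism of bimodules
   means that A with [tinv_i1] is a model of the completed tensor product. *)
Record top_inverse_bimodules (K : numFieldType) (A : arensMichaelType K) :=
    TopInverseBimodules {
  tinv_fwd : top_bimodule A;
  tinv_bwd : top_bimodule A;
  tinv_i1 : tinv_fwd -> tinv_bwd -> top_regular A;
  tinv_i2 : tinv_bwd -> tinv_fwd -> top_regular A;
  tinv_i1_iso : is_top_tensor tinv_i1;
  tinv_i2_iso : is_top_tensor tinv_i2;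
  tinv_i12 : forall x y x', tlact (tinv_i1 x y) x' = tract x (tinv_i2 y x');
  tinv_i21 : forall y x y', tlact (tinv_i2 y x) y' = tract y (tinv_i1 x y')
}.

Program Definition top_twist_inverse (K : numFieldType) (A : arensMichaelType K)
    (s : top_alg_aut A) : top_inverse_bimodules A :=
  @TopInverseBimodules K A (top_twist s) (top_twist (top_aut_sym s))
    (top_twist_mul (s := s) (s' := top_aut_sym s))
    (top_twist_mul (s := top_aut_sym s) (s' := s)) _ _ _ _.
Next Obligation.
by move=> K A s; apply: top_twist_tensor; [exact: autK|exact: aut_invK].
Qed.
Next Obligation.
by move=> K A s; apply: top_twist_tensor; [exact: aut_invK|exact: autK].
Qed.
Next Obligation.
move=> K A s x y x'; rewrite /top_twist_mul /=.
by have [_ _ ->] := aut_hom s; rewrite aut_invK amulA.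
Qed.
Next Obligation.
move=> K A s y x y'; rewrite /top_twist_mul /=.
by have [_ _ ->] := aut_inv_hom s; rewrite autK amulA.
Qed.

Definition top_bimodule_hom_to (K : numFieldType) (A B : arensMichaelType K)
    (theta : A -> B) (M : top_bimodule A) (f : M -> B) : Prop :=
  [/\ linear f, continuous f, forall a x, f (tlact a x) = theta a ** f x &
      forall x a, f (tract x a) = f x ** theta a].

Record compatible_triple (K : numFieldType) (A : arensMichaelType K)
    (I : top_inverse_bimodules A) := CompatibleTriple {
  ct_alg :> arensMichaelType K;
  ct_theta : A -> ct_alg;
  ct_alpha : tinv_fwd I -> ct_alg;
  ct_beta : tinv_bwd I -> ct_alg;
  ct_theta_hom : alg_hom ct_theta;
  ct_theta_cont : continuous ct_theta;
  ct_alpha_hom : top_bimodule_hom_to ct_theta ct_alpha;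
  ct_beta_hom : top_bimodule_hom_to ct_theta ct_beta;
  ct_alpha_beta : forall x y, ct_alpha x ** ct_beta y = ct_theta (tinv_i1 x y);
  ct_beta_alpha : forall y x, ct_beta y ** ct_alpha x = ct_theta (tinv_i2 y x)
}.

Record top_laurent_tensor_algebra (K : numFieldType) (A : arensMichaelType K)
    (I : top_inverse_bimodules A) := TopLaurentTensorAlgebra {
  tlta_triple :> compatible_triple I;
  tlta_universal : forall T : compatible_triple I,
    exists! f : tlta_triple -> T,
      [/\ alg_hom f, continuous f, f \o ct_theta tlta_triple = ct_theta T,
          f \o ct_alpha tlta_triple = ct_alpha T &
          f \o ct_beta tlta_triple = ct_beta T]
}.

(* Main.v *)
Require Import Defs.
(* A homomorphism from A[t, t^-1; alpha] to B is a homomorphism h : A -> B with an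
   invertible u in B such that u h(a) = h(alpha(a)) u. A compatible triple over
   the envelope of A amounts to the same data (theta, u = image of 1 in A_alpha,
   u^-1 = image of 1 in A_(alpha^-1)): the relation between u and theta passes
   from A to its envelope because continuous homomorphisms out of the envelope
   are determined on A. So both sides have the same universal property. On the
   algebraic side, A[t, t^-1; alpha] -> L_A(A_alpha) is inverted degree by
   degree. *)
From HB Require Import structures.
From mathcomp Require Import all_boot all_order all_algebra.
From mathcomp Require Import finmap.
From mathcomp Require Import complex.
From mathcomp Require Import boolp classical_sets functions reals topology.
From mathcomp Require Import normedtype.

Set Implicit Arguments.
Unset Strict Implicit.
Unset Printing Implicit Defensive.

Import Order.TTheory GRing.Theory Num.Theory.
Import numFieldNormedType.Exports.

Local Open Scope classical_set_scope.
Local Open Scope ring_scope.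
Local Open Scope complex_scope.

(** * Composition and inversion of algebra homomorphisms *)

Lemma hom_comp (K : fieldType) (A B C : algebraType K) (g : B -> C)
    (f : A -> B) :
  alg_hom g -> alg_hom f -> alg_hom (g \o f).
Proof.
move=> [gl g1 gM] [fl f1 fM]; split; rewrite /= ?f1 ?g1//.
  by move=> k x y /=; rewrite fl gl.
by move=> x y /=; rewrite fM gM.
Qed.

Lemma hom_inv (K : fieldType) (A B : algebraType K) (f : A -> B) (g : B -> A) :
  cancel f g -> cancel g f -> alg_hom f -> alg_hom g.
Proof.
move=> fK gK [fl f1 fM]; have fI := can_inj fK.
split=> [k x y||x y]; apply: fI.
- by rewrite fl !gK.
- by rewrite gK f1.
- by rewrite fM !gK.
Qed.

(** * The universal property of the Laurent Ore extension *)

Section OreUniversal.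
Context (K : fieldType) (A : algebraType K) (s : alg_aut A).
Local Notation ore := (laurent_ore s).

Lemma ore_monoM a m b n :
  ore_mono s a m ** ore_mono s b n = ore_mono s (a ** autz s m b) (m + n).
Proof. exact: ore_mul_mono. Qed.

Lemma autz1 n : autz s n aone = aone.
Proof. by have [] := autz_hom s n. Qed.

Lemma ore_mono_linear n : linear (ore_mono s ^~ n).
Proof. by move=> k a b; rewrite ore_monoD ore_monoZ. Qed.

Lemma ore_mono_hom0 : alg_hom ((ore_mono s)^~ 0 : A -> ore).
Proof.
split=> //; first exact: ore_mono_linear.
by move=> a b; rewrite ore_monoM.
Qed.

Lemma ore_linear_ext (E : lmodType K) (f g : ore -> E) : linear f -> linear g ->
  (forall a n, f (ore_mono s a n) = g (ore_mono s a n)) -> f = g.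
Proof.
move=> fl gl fg; apply: funext => x; rewrite (ore_expand x).
have lin0 (h : ore -> E) : linear h -> h 0 = 0.
  by move=> hl; have := hl (-1) 0 0; rewrite scaler0 addr0 scaleN1r addNr.
elim: (finsupp x : seq int) => [|i r IH]; first by rewrite big_nil !lin0.
rewrite big_cons -[ore_mono _ _ _]scale1r fl gl fg; congr (_ + _).
exact: IH.
Qed.

(** The coefficients, t and t^-1 generate the algebra: a t^n = a * t^n, and t^n is reached from t^0
    by induction in both directions. *)
Lemma ore_hom_ext (B : algebraType K) (f g : ore -> B) :
  alg_hom f -> alg_hom g ->
  (forall a, f (ore_mono s a 0) = g (ore_mono s a 0)) ->
  f (ore_mono s aone 1) = g (ore_mono s aone 1) ->
  f (ore_mono s aone (- 1)) = g (ore_mono s aone (- 1)) -> f = g.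
Proof.
move=> [fl f1 fM] [gl g1 gM] fg0 fg1 fgN.
apply: ore_linear_ext => // a n.
have -> : ore_mono s a n = ore_mono s a 0 ** ore_mono s aone n.
  by rewrite ore_monoM autz1 amulx1 add0r.
rewrite fM gM fg0; congr (_ ** _); elim/int_ind: n => // n IH.
  have -> : ore_mono s aone n.+1 = ore_mono s aone n ** ore_mono s aone 1.
    by rewrite ore_monoM autz1 amulx1 -addn1 PoszD.
  by rewrite fM gM IH fg1.
have -> : ore_mono s aone (- n.+1%:Z) =
    ore_mono s aone (- n%:Z) ** ore_mono s aone (- 1).
  by rewrite ore_monoM autz1 amulx1 -addn1 PoszD opprD.
by rewrite fM gM IH fgN.
Qed.

Section Lift.
Context (B : algebraType K) (h : A -> B) (u v : B).
Hypotheses (h_hom : alg_hom h) (uv : u ** v = aone) (vu : v ** u = aone).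
Hypothesis uh : forall a, u ** h a = h (s a) ** u.

(** The power u^n, with [v] as u^-1. The case split is that of [autz], so the two recursions run in
    parallel. *)
Definition upow (n : int) : B :=
  match n with
  | Posz n => iter n (amul u) aone
  | Negz n => iter n.+1 (amul v) aone
  end.

Lemma upowS n : upow (n + 1) = u ** upow n.
Proof.
case: n => [n|[|n]]; first by rewrite -PoszD addn1.
  by rewrite /= amulx1 uv.
have -> : Negz n.+1 + 1 = Negz n.
  by rewrite !NegzE -[n.+2]addn1 PoszD opprD subrK.
by rewrite /= [RHS]amulA uv amul1x.
Qed.

Lemma upowB n : upow (n - 1) = v ** upow n.
Proof. by rewrite -{2}(subrK 1 n) upowS amulA vu amul1x. Qed.

Lemma upowD m n : upow (m + n) = upow m ** upow n.
Proof.
elim/int_ind: m => [|m IH|m IH]; first by rewrite add0r amul1x.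
- by rewrite -addn1 PoszD addrAC !upowS IH amulA.
- by rewrite -addn1 PoszD opprD addrAC !upowB IH amulA.
Qed.

Lemma upow_comm n a : upow n ** h a = h (autz s n a) ** upow n.
Proof.
(* Conjugating [uh] by [v]: with b = s(c), v h(s c) = v h(s c) u v = v u h(c) v = h(c) v. *)
have vh b : v ** h b = h (aut_inv s b) ** v.
  rewrite -{1}(aut_invK s b) -[LHS]amulx1 -uv amulA -(amulA v) -uh.
  by rewrite amulA vu amul1x.
elim/int_ind: n => [|n IH|n IH]; first by rewrite amul1x amulx1.
- by rewrite -addn1 PoszD upowS autzS -amulA IH !amulA uh.
- by rewrite -addn1 PoszD opprD upowB autzB -amulA IH !amulA vh.
Qed.

Definition ore_lift (f : ore) : B := \sum_(i <- finsupp f) h (f i) ** upow i.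

Lemma ore_lift_mono a n : ore_lift (ore_mono s a n) = h a ** upow n.
Proof.
rewrite /ore_lift (@big_finsupp_mono _ _ _ _ a n
  (fun i a => h a ** upow i))// => i.
by rewrite (alg_hom0 h_hom) amul0l.
Qed.

Lemma ore_lift_linear : linear ore_lift.
Proof.
move=> k f g; rewrite /ore_lift.
rewrite (@big_finsuppD _ _ _ _ (k *: f) g
  (fun i a => h a ** upow i)); last first.
  by move=> i a b; rewrite (alg_homD h_hom) amulDl.
rewrite (@big_finsuppZ _ _ _ _ k f (fun i a => h a ** upow i))// => [i a|i].
  by rewrite (alg_homZ _ h_hom) amulZl.
by rewrite (alg_hom0 h_hom) amul0l.
Qed.

(** Both sides of the multiplicativity law are bilinear, so monomials suffice; there [upow_comm]
    moves u^m past h(b). *)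
Lemma ore_lift_hom : alg_hom ore_lift.
Proof.
have [hl h1 hM] := h_hom; have ll := ore_lift_linear.
split=> //; first by rewrite ore_lift_mono h1 amul1x.
move=> f g.
(* First the right factor is reduced to a monomial with [f] fixed, then the left one through [G1]
   and [G2]. *)
pose F1 x : B := ore_lift (f ** x); pose F2 x : B := ore_lift f ** ore_lift x.
apply: (congr1 (fun F => F g) (_ : F1 = F2)).
apply: ore_linear_ext; rewrite /F1 /F2.
- by move=> k x y; rewrite linear_amull ll.
- by move=> k x y; rewrite ll linear_amull.
move=> b n.
pose G1 x : B := ore_lift (x ** ore_mono s b n).
pose G2 x : B := ore_lift x ** ore_lift (ore_mono s b n).
apply: (congr1 (fun F => F f) (_ : G1 = G2)).
apply: ore_linear_ext; rewrite /G1 /G2.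
- by move=> k x y; rewrite linear_amulr ll.
- by move=> k x y; rewrite ll linear_amulr.
move=> a m; rewrite ore_monoM !ore_lift_mono hM upowD.
by rewrite !amulA -(amulA _ (upow m) (h b)) upow_comm amulA.
Qed.

End Lift.
End OreUniversal.

(** * The Laurent tensor algebra of the twisted bimodule, compared with the Ore extension *)

Lemma tensor_ext (K : fieldType) (A : algebraType K) (M N T : bimodule A)
    (tau : M -> N -> T) (E : lmodType K) (g1 g2 : T -> E) :
  is_tensor tau -> linear g1 -> linear g2 ->
  (forall x y, g1 (tau x y) = g2 (tau x y)) -> g1 = g2.
Proof.
move=> [[[taul taur] taub] _ _ tauU] g1l g2l g12.
(* The composite of [g1] with [tau] is balanced, so the uniqueness half of the universal property
   applies to both maps. *)
have [|g [_ gU]] := tauU E (fun x y => g1 (tau x y)).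
  split; last by move=> x a y; rewrite taub.
  split=> [x k y z|y k x z]; first by rewrite taul g1l.
  by rewrite -g1l; congr g1; exact: taur.
have <- := gU g1 (conj g1l (fun x y => erefl)).
by apply: gU; split=> // x y; rewrite g12.
Qed.

Section LaurentTensorOre.
Context (K : fieldType) (A : algebraType K) (s : alg_aut A).
Context (L : laurent_tensor_algebra (twist_inverse s)).
Local Notation ore := (laurent_ore s).

Lemma lta_unit_ract a : ract (lta_unit L aone) a = lta_unit L a.
Proof.
have [[_ _ ur] _] := lta_unit_iso L.
by rewrite -ur /= amul1x.
Qed.

Lemma lta_unit_lact a : lact a (lta_unit L aone) = lta_unit L a.
Proof.
have [[_ ul _] _] := lta_unit_iso L.
by rewrite -ul /= amulx1.
Qed.

(** Balancedness moves x across the tensor sign: 1 (x) x = 1 (x) (x * 1) = x (x) 1. *)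
Lemma lta_fwdE x : lta_fwd L x = lta_of_alg L x ** lta_fwd L aone.
Proof.
have [[_ taub] taul _ _] := lta_tensP_tensor L 0.
rewrite -lta_emb_lact -taul lta_unit_lact; congr lta_emb.
rewrite -[in RHS]lta_unit_ract taub.
by rewrite /= amulx1.
Qed.

Lemma lta_bwdE y : lta_bwd L y = lta_of_alg L y ** lta_bwd L aone.
Proof.
have [[_ taub] taul _ _] := lta_tensN_tensor L 0.
rewrite -lta_emb_lact -taul lta_unit_lact; congr lta_emb.
rewrite -[in RHS]lta_unit_ract taub.
by rewrite /= amulx1.
Qed.

(** The right action on the twisted bimodule gives 1 . a = s(a), and [lta_fwdE] pulls s(a) out on
    the left. *)
Lemma lta_fwd_comm a :
  lta_fwd L aone ** lta_of_alg L a = lta_of_alg L (s a) ** lta_fwd L aone.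
Proof.
have [_ _ taur _] := lta_tensP_tensor L 0.
by rewrite -lta_emb_ract -taur -lta_fwdE /= amul1x.
Qed.

(** Here t goes to the 1 of the bimodule and t^-1 to the 1 of its inverse. *)
Definition ore_to_lta : ore -> L :=
  ore_lift (lta_of_alg L) (lta_fwd L aone) (lta_bwd L aone).

Lemma lta_fwd_bwd1 : lta_fwd L aone ** lta_bwd L aone = aone.
Proof.
have [_ s1 _] := aut_hom s; have [_ h1 _] := lta_of_alg_hom L.
by rewrite lta_fwd_bwd /= /twist_mul s1 amulx1.
Qed.

Lemma lta_bwd_fwd1 : lta_bwd L aone ** lta_fwd L aone = aone.
Proof.
have [_ s1 _] := aut_inv_hom s; have [_ h1 _] := lta_of_alg_hom L.
by rewrite lta_bwd_fwd /= /twist_mul /= s1 amulx1.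
Qed.

Lemma ore_to_lta_hom : alg_hom ore_to_lta.
Proof.
exact: (ore_lift_hom (lta_of_alg_hom L) lta_fwd_bwd1 lta_bwd_fwd1 lta_fwd_comm).
Qed.

Lemma ore_to_lta_alg a : ore_to_lta (ore_mono s a 0) = lta_of_alg L a.
Proof.
by rewrite /ore_to_lta ore_lift_mono ?amulx1//; exact: lta_of_alg_hom.
Qed.

Lemma ore_to_lta_fwd x : ore_to_lta (ore_mono s x 1) = lta_fwd L x.
Proof.
rewrite /ore_to_lta ore_lift_mono; last exact: lta_of_alg_hom.
by rewrite /= amulx1 -lta_fwdE.
Qed.

Lemma ore_to_lta_bwd y : ore_to_lta (ore_mono s y (- 1)) = lta_bwd L y.
Proof.
rewrite /ore_to_lta ore_lift_mono; last exact: lta_of_alg_hom.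
by rewrite /= amulx1 -lta_bwdE.
Qed.

(* f inverts [ore_to_lta] in degree n on the summand e : W -> L. Right linearity
   is what lets f be extended to the next tensor power. *)
Definition degree_inverse n (W : bimodule A) (e : W -> L) (f : W -> ore) :
    Prop :=
  [/\ linear f,
      forall w a, f (ract w a) = f w ** ore_mono s a 0,
      forall w, ore_to_lta (f w) = e w &
      forall a, exists2 w, e w = ore_to_lta (ore_mono s a n) &
                           f w = ore_mono s a n].

Lemma degree_inverse0 :
  exists f, degree_inverse 0 (@lta_emb _ _ _ L 0) f.
Proof.
have [[ul ulact uract] [ui uK uiK]] := lta_unit_iso L.
have uI := can_inj uK.
exists (fun w => ore_mono s (ui w) 0); split.
- move=> k x y; rewrite -ore_mono_linear; congr ore_mono.
  by apply: uI; rewrite ul !uiK.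
- move=> w a; rewrite ore_monoM; congr ore_mono.
  by apply: uI; rewrite uract !uiK.
- by move=> w; rewrite ore_to_lta_alg /lta_of_alg uiK.
- move=> a; exists (lta_unit L a); first by rewrite ore_to_lta_alg.
  by rewrite uK.
Qed.

(** The inverse in the next degree is f'(w (x) x) = f(w) * x t^k; it is balanced because f(w a) =
    f(w) a. Used with k = 1 for the positive powers and k = -1 for the negative ones. *)
Lemma degree_inverse_tensor n k (s' : alg_aut A) (W W' : bimodule A)
    (tau : W -> twist s' -> W') (e : W -> L) (e' : W' -> L) :
  autz s k =1 s' -> is_tensor tau -> linear e' ->
  (forall w x, e w ** ore_to_lta (ore_mono s x k) = e' (tau w x)) ->
  (exists f, degree_inverse n e f) -> exists f, degree_inverse (n + k) e' f.
Proof.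
move=> sk tauT e'l ee' [f [fl fr fe fn]].
have [[_ _] _ taur tauU] := tauT.
have [_ _ oM] := ore_to_lta_hom; have [ol _ _] := ore_to_lta_hom.
have [|f' [[f'l f'tau] _]] := tauU ore (fun w x => f w ** ore_mono s x k).
  split; last first.
    by move=> w a x; rewrite fr -amulA ore_monoM add0r.
  split=> [w c x y|x c w w'].
    by rewrite ore_mono_linear linear_amull.
  by rewrite fl linear_amulr.
exists f'; split=> //.
- move=> w a; move: w.
  apply: (fun E w => congr1 (fun g => g w) (E : (fun w => f' (ract w a)) = _)).
  apply: (tensor_ext tauT).
  + have [_ [rl _ _ _] _] := bm_laws W'.
    by move=> c x y; rewrite -f'l; congr f'; exact: rl.
  + by move=> c x y; rewrite f'l linear_amulr.
  (* Moving a past t^k applies [autz s k], which by [sk] is exactly the twist of the right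
     action. *)
  + move=> w x; rewrite -taur !f'tau -amulA ore_monoM addr0 sk.
    by [].
- move=> w; move: w.
  apply: (fun E w => congr1 (fun g => g w) (E : ore_to_lta \o f' = e')).
  apply: (tensor_ext tauT) => //.
  + by move=> c x y; rewrite /= f'l ol.
  + by move=> w x; rewrite /= f'tau oM fe ee'.
(* Since a t^(n+k) = a t^n * t^k, the preimage is w (x) 1 with w the preimage of a t^n. *)
- move=> a; have [w ew fw] := fn a.
  have monoE : ore_mono s a (n + k) = ore_mono s a n ** ore_mono s aone k.
    by rewrite ore_monoM autz1 amulx1.
  exists (tau w aone); first by rewrite -ee' ew monoE oM.
  by rewrite f'tau fw monoE.
Qed.

Lemma degree_inverse_ex (n : int) :
  exists f, degree_inverse n (@lta_emb _ _ _ L n) f.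
Proof.
have ss : autz s 1 =1 s by [].
have ss' : autz s (- 1) =1 aut_sym s by [].
elim/int_ind: n => [|n IH|n IH]; first exact: degree_inverse0.
- have := degree_inverse_tensor ss (lta_tensP_tensor L n)
    (lta_emb_linear (l := L) (n := n.+1%:Z)) _ IH.
  rewrite -PoszD addn1; apply=> w x.
  by rewrite ore_to_lta_fwd lta_mulP.
- have := degree_inverse_tensor ss' (lta_tensN_tensor L n)
    (lta_emb_linear (l := L) (n := - n.+1%:Z)) _ IH.
  rewrite -opprD -PoszD addn1; apply=> w y.
  by rewrite ore_to_lta_bwd lta_mulN.
Qed.

Lemma ore_to_lta_bij : bijective ore_to_lta.
Proof.
have [ol _ _] := ore_to_lta_hom.
pose f n := projT1 (cid (degree_inverse_ex n)).
have fP n : degree_inverse n (@lta_emb _ _ _ L n) (f n).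
  by rewrite /f; case: cid.
(* The direct sum property glues the degreewise inverses into one linear map. *)
have [|phi [[phil phif] _]] := @lta_direct_sum _ _ _ L _ f.
  by move=> n; have [] := fP n.
(* Only uniqueness is kept here: a linear endomorphism of [L] that fixes every summand is the
   identity. *)
have [|i [_ iU]] := @lta_direct_sum _ _ _ L _ (fun n => @lta_emb _ _ _ L n).
  exact: lta_emb_linear.
exists phi.
- apply: (fun E x => congr1 (fun g => g x) (E : phi \o ore_to_lta = id)).
  apply: ore_linear_ext => //; first by move=> k x y; rewrite /= ol phil.
  (* The last clause of [degree_inverse] supplies a summand element with the same image as a t^n, on
     which [phi] is known. *)
  move=> a n; have [_ _ _ /(_ a)[w ew fw]] := fP n.
  by rewrite /= -ew phif fw.
- apply: (fun E x => congr1 (fun g => g x) (E : ore_to_lta \o phi = id)).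
  rewrite -(iU id)// -(iU (ore_to_lta \o phi))//; split.
    by move=> k x y; rewrite /= phil ol.
  by move=> n w; rewrite /= phif; have [_ _ -> _] := fP n.
Qed.

End LaurentTensorOre.

(** * Arens-Michael envelopes and continuity of multiplication *)

Lemma am_envelope_ext (K : numFieldType) (A : algebraType K)
    (Ah B : arensMichaelType K) (i : A -> Ah) (f g : Ah -> B) :
  is_am_envelope i -> alg_hom f -> continuous f -> alg_hom g -> continuous g ->
  (forall a, f (i a) = g (i a)) -> f = g.
Proof.
move=> [ih iU] fh fc gh gc fg.
have [e [_ eU]] := iU B (f \o i) (hom_comp fh ih).
rewrite -(eU f)// -(eU g)//; split=> //.
by apply: funext => a; rewrite /= fg.
Qed.

(** A homomorphism out of A' is transported to A along the inverse of [phi], extended there, and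
    pulled back. *)
Lemma am_envelope_precomp (K : numFieldType) (A A' : algebraType K)
    (Ah : arensMichaelType K) (i : A -> Ah) (phi : A' -> A) :
  is_am_envelope i -> alg_hom phi -> bijective phi -> is_am_envelope (i \o phi).
Proof.
move=> [ih iU] phih [phi' phiK phiK'].
have phih' := hom_inv phiK phiK' phih.
split=> [|B f fh]; first exact: hom_comp.
have [g [[gh gc gi] gU]] := iU B (f \o phi') (hom_comp fh phih').
exists g; split.
  split=> //; apply: funext => x.
  by rewrite -[in RHS](phiK x) -[RHS]/((f \o phi') _) -gi.
move=> g' [g'h g'c g'i]; apply: gU; split=> //.
by apply: funext => x; rewrite -g'i /= phiK'.
Qed.

Lemma amull_continuous (K : numFieldType) (A : arensMichaelType K) (a : A) :
  continuous (amul a).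
Proof.
move=> x; apply: (@continuous_comp _ _ _ (fun x : A => (a, x))
                                   (fun z : A * A => z.1 ** z.2)).
  by apply: cvg_pair; [exact: cvg_cst|exact: cvg_id].
exact: amul_continuous.
Qed.

Lemma amulr_continuous (K : numFieldType) (A : arensMichaelType K) (a : A) :
  continuous (amul^~ a).
Proof.
move=> x; apply: (@continuous_comp _ _ _ (fun x : A => (x, a))
                                   (fun z : A * A => z.1 ** z.2)).
  by apply: cvg_pair; [exact: cvg_id|exact: cvg_cst].
exact: amul_continuous.
Qed.

(** * The envelope of the Ore extension and the topological Laurent tensor algebra *)

Section TopologicalLaurent.
Context (K : numFieldType) (A : algebraType K) (s : alg_aut A).
Context (Ah : arensMichaelType K) (iA : A -> Ah).
Context (iA_envelope : is_am_envelope iA).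
Context (sh : top_alg_aut Ah) (sh_iA : forall a, sh (iA a) = iA (s a)).

(** The envelope property of [Oh] yields [psi]; a compatible triple on [Oh] yields [g] in the other
    direction. Each composite is the identity by the uniqueness half of the universal property of
    its source. *)
Lemma top_laurent_iso (Oh : arensMichaelType K) (iO : laurent_ore s -> Oh)
    (Lh : top_laurent_tensor_algebra (top_twist_inverse sh)) :
  is_am_envelope iO -> exists psi : Oh -> Lh, top_alg_iso psi.
Proof.
move=> iO_envelope.
have [iAh iAU] := iA_envelope; have [iOh iOU] := iO_envelope.
have [_ s1 _] := aut_hom sh; have [_ si1 _] := aut_inv_hom sh.
pose th := ct_theta Lh; pose u := ct_alpha Lh aone; pose v := ct_beta Lh aone.
have thh : alg_hom th by exact: ct_theta_hom.
have [_ th1 thM] := thh.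
have alE x : ct_alpha Lh x = th x ** u.
  by have [_ _ <- _] := ct_alpha_hom Lh; rewrite /= amulx1.
have beE y : ct_beta Lh y = th y ** v.
  by have [_ _ <- _] := ct_beta_hom Lh; rewrite /= amulx1.
have uv : u ** v = aone.
  by rewrite /u /v ct_alpha_beta /= /top_twist_mul /= s1 amulx1.
have vu : v ** u = aone.
  by rewrite /u /v ct_beta_alpha /= /top_twist_mul /= si1 amulx1.
have uth a : u ** th a = th (sh a) ** u.
  by rewrite -alE; have [_ _ _ <-] := ct_alpha_hom Lh; rewrite /= amul1x.
have uthA a : u ** (th \o iA) a = (th \o iA) (s a) ** u by rewrite /= uth sh_iA.
have thAh : alg_hom (th \o iA) by exact: hom_comp.
have lifth := ore_lift_hom thAh uv vu uthA.
have [psi [[psih psic psiO] _]] := iOU _ _ lifth.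
have psi_iO x : psi (iO x) = ore_lift (th \o iA) u v x by rewrite -psiO.
have [_ _ iOM] := iOh; have [_ iO1 _] := iOh.
(* The inclusion of A in degree 0, followed by [iO], extends to the envelope of A; this is the
   structure map of the triple on [Oh]. *)
have [theta [[thetah thetac thetai] _]] :=
  iAU Oh _ (hom_comp iOh (ore_mono_hom0 s)).
have theta_iA a : theta (iA a) = iO (ore_mono s a 0).
  by rewrite -[LHS]/((theta \o iA) a) thetai.
pose t := iO (ore_mono s aone 1); pose t' := iO (ore_mono s aone (- 1)).
have tt' : t ** t' = aone.
  by rewrite -iOM ore_monoM autz1 amulx1 -iO1.
have t't : t' ** t = aone.
  by rewrite -iOM ore_monoM autz1 amulx1 -iO1.
have [thl th11 thMM] := thetah.
(* a |-> t theta(a) t^-1 and theta o sh are continuous and agree on A. *)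
have ttheta a : t ** theta a = theta (sh a) ** t.
  have E : (fun a => t ** theta a ** t') = theta \o sh.
    apply: (am_envelope_ext iA_envelope).
    - split=> [k x y||x y]; first by rewrite thl linear_amull linear_amulr.
        by rewrite th11 amulx1.
      by rewrite thMM !amulA -(amulA _ t' t) t't amulx1.
    - move=> x; apply: (@continuous_comp _ _ _ (fun a => t ** theta a)
                                         (amul^~ t')).
        apply: (@continuous_comp _ _ _ theta (amul t)); first exact: thetac.
        exact: amull_continuous.
      exact: amulr_continuous.
    - exact: (hom_comp thetah (aut_hom sh)).
    - by move=> x; apply: continuous_comp; [exact: top_aut_cont|exact: thetac].
    - move=> b; rewrite /= sh_iA !theta_iA -!iOM !ore_monoM.
      by rewrite autz1 amulx1 amul1x.
  by rewrite -[theta (sh a)](congr1 (fun g => g a) E) -!amulA t't amulx1.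
have t'theta a : t' ** theta a = theta (aut_inv sh a) ** t'.
  rewrite -{1}(aut_invK sh a) -[LHS]amulx1 -tt' amulA -(amulA t') -ttheta.
  by rewrite amulA t't amul1x.
(* The bimodule maps are right multiplication by t and t^-1 after [theta]; right linearity is the
   commutation relation just shown. *)
have [al_hom be_hom] :
  top_bimodule_hom_to theta (M := top_twist sh) (fun x => theta x ** t) /\
  top_bimodule_hom_to theta (M := top_twist (top_aut_sym sh))
    (fun y => theta y ** t').
  have c (x : Oh) : continuous (fun a => theta a ** x).
    move=> a; apply: (@continuous_comp _ _ _ theta (amul^~ x)).
      exact: thetac.
    exact: amulr_continuous.
  split; split.
  - by move=> k x y; rewrite thl linear_amulr.
  - exact: c.
  - by move=> a x; rewrite /= thMM amulA.
  - by move=> x a; rewrite /= thMM -!amulA ttheta.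
  - by move=> k x y; rewrite thl linear_amulr.
  - exact: c.
  - by move=> a x; rewrite /= thMM amulA.
  - by move=> x a; rewrite /= thMM -!amulA t'theta.
have [ab ba] :
  (forall x y, theta x ** t ** (theta y ** t') = theta (x ** sh y)) /\
  (forall y x, theta y ** t' ** (theta x ** t) = theta (y ** aut_inv sh x)).
  split=> x y.
    by rewrite amulA -(amulA _ t) ttheta thMM -!amulA tt' amulx1.
  by rewrite amulA -(amulA _ t') t'theta thMM -!amulA t't amulx1.
pose T := @CompatibleTriple K Ah (top_twist_inverse sh) Oh theta _ _
  thetah thetac al_hom be_hom ab ba.
have [g [[gh gc gth gal gbe] _]] := tlta_universal Lh T.
(* Both sides are continuous homomorphisms on [Ah], so it suffices to compare them on A. *)
have psi_theta a : psi (theta a) = th a.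
  apply: (congr1 (fun f => f a) (_ : psi \o theta = th)).
  apply: (am_envelope_ext iA_envelope) => //.
  - exact: hom_comp.
  - by move=> x; apply: continuous_comp; [exact: thetac|exact: psic].
  - exact: ct_theta_cont.
  - by move=> b; rewrite /= theta_iA psi_iO ore_lift_mono//= amulx1.
have psi_t : psi t = u.
  rewrite psi_iO ore_lift_mono//=; have [_ -> _] := iAh.
  by rewrite th1 amulx1 amul1x.
have psi_t' : psi t' = v.
  rewrite psi_iO ore_lift_mono//=; have [_ -> _] := iAh.
  by rewrite th1 amulx1 amul1x.
have [_ _ psiM] := psih.
exists psi; split=> //; exists g; split=> //.
- move=> x; apply: (congr1 (fun f => f x) (_ : g \o psi = id)).
  apply: (am_envelope_ext iO_envelope) => //.
  + exact: hom_comp.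
  + by move=> y; apply: continuous_comp; [exact: psic|exact: gc].
  + by move=> y; exact: cvg_id.
  (* Agreement on the coefficients, t and t^-1 is enough by [ore_hom_ext]. *)
  have gpsi : g \o psi \o iO = iO.
    apply: ore_hom_ext => //; first by do 2! apply: hom_comp => //.
    * by move=> a; rewrite /= -theta_iA psi_theta -[LHS]/((g \o th) _) gth.
    * by rewrite /= psi_t -[LHS]/((g \o _) _) gal /= th11 amul1x.
    * by rewrite /= psi_t' -[LHS]/((g \o _) _) gbe /= th11 amul1x.
  by move=> y; rewrite -[LHS]/((g \o psi \o iO) y) gpsi.
(* The universal property of [Lh] is applied to its own triple, which both [psi \o g] and the
   identity preserve. *)
- have [e [_ eU]] := tlta_universal Lh Lh.
  move=> x; apply: (congr1 (fun f => f x) (_ : psi \o g = id)).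
  apply: (etrans (esym (eU (psi \o g) _)) (eU id _)); split=> //; last first.
  + by move=> y; exact: cvg_id.
  + rewrite -compA gbe; apply: funext => a.
    by rewrite /= psiM psi_theta psi_t' beE.
  + rewrite -compA gal; apply: funext => a.
    by rewrite /= psiM psi_theta psi_t alE.
  + by rewrite -compA gth; apply: funext => a; rewrite /= psi_theta.
  + by move=> y; apply: continuous_comp; [exact: gc|exact: psic].
  + exact: hom_comp.
Qed.

End TopologicalLaurent.

(* [Ah] is the envelope of A, [Oh] that of A[t, t^-1; alpha], [L] is L_A(A_alpha)
   and [Lh] is the topological Laurent tensor algebra. [phi] is the standard
   identification of L_A(A_alpha) with A[t, t^-1; alpha], through which [Oh] is
   also the envelope of L_A(A_alpha). *)
Theorem corollary2p1 (R : realType) (A : algebraType R[i]) (alpha : alg_aut A)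
    (Ah : arensMichaelType R[i]) (iA : A -> Ah)
    (iA_envelope : is_am_envelope iA) (Ah_frechet : frechet Ah)
    (alphah : top_alg_aut Ah)
    (alphah_iA : forall a : A, alphah (iA a) = iA (alpha a))
    (L : laurent_tensor_algebra (twist_inverse alpha))
    (Oh : arensMichaelType R[i]) (iO : laurent_ore alpha -> Oh)
    (iO_envelope : is_am_envelope iO)
    (Lh : top_laurent_tensor_algebra (top_twist_inverse alphah)) :
  (exists phi : L -> laurent_ore alpha,
    [/\ alg_hom phi /\ bijective phi,
        forall a : A, phi (lta_of_alg L a) = ore_mono alpha a 0,
        forall x : A, phi (lta_fwd L x) = ore_mono alpha x 1,
        forall y : A, phi (lta_bwd L y) = ore_mono alpha y (- 1) &
        is_am_envelope (iO \o phi)]) /\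
  (exists psi : Oh -> Lh, top_alg_iso psi).
Proof.
split; last exact: (top_laurent_iso iA_envelope alphah_iA Lh iO_envelope).
(* [phi] is the inverse of [ore_to_lta], so its values on generators come from those of
   [ore_to_lta]. *)
have psih := ore_to_lta_hom L; have [phi psiK phiK] := ore_to_lta_bij L.
have phih := hom_inv psiK phiK psih.
have phib : bijective phi by exists (ore_to_lta L).
exists phi; split=> //.
- by move=> a; rewrite -ore_to_lta_alg psiK.
- by move=> x; rewrite -ore_to_lta_fwd psiK.
- by move=> y; rewrite -ore_to_lta_bwd psiK.
- exact: am_envelope_precomp.
Qed.
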